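(* Let $(X,d)$ be a compact metric space, $T:X\to X$ continuous, $\mu$ a $T$-invariant Borel probability measure on $X$, and $\mathcal{A}$ a finite or countably infinite measurable generating partition of $X$ with respect to which $\mu$ is $\alpha$-mixing; put $\gamma_k=\operatorname{diam}(\mathcal{A}^k)$. Assume there exist $\epsilon_0>0$ and an increasing sequence of integers $\{N(n)\}_{n=1}^\infty$ satisfying $n<N(n)<\frac14\mu(B_{\epsilon,n}(x))^{-1}$ such that $$\varphi(\epsilon,\gamma_{N(n)-k},T^kx)\le\vartheta_n(\epsilon)\cdot\frac{\mu(B_{\epsilon,n}(x))}{n\,s}$$ for all $\epsilon<\epsilon_0$, $x\in X$, $0\le k\le n-1$, where $s=\alpha^{-1}(C'\mu(\widetilde B_{\epsilon,n}(x)))+N(n)$ for some $0<C'<1$, and $\vartheta_n(\epsilon)\to0$ as $n\to\infty$ for every $\epsilon$. Then there exist $\lambda_{B_{\epsilon,n}(x)}$ with $\frac{C}{s}<\lambda_{B_{\epsilon,n}(x)}<2$ (for a constant $C>0$) and constants $C_5,C_6$ such that, for all $t>0$, $$\left|\mathbb{P}\!\left(\tau_{B_{\epsilon,n}(x)}>\frac{t}{\lambda_{B_{\epsilon,n}(x)}\mu(B_{\epsilon,n}(x))}\right)-e^{-t}\right|\le\vartheta_n(\epsilon)\frac{t}{s\lambda_{B_{\epsilon,n}(x)}}+2f\mu(B_{\epsilon,n}(x))+C_5\frac{sN(n)}{f}+C_6\,s\,\frac{\alpha(N(n))}{f\,\mu(\widetilde B_{\epsilon,n}(x))}$$ for all 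$f\in\left(2N(n),\frac12\mu(B_{\epsilon,n}(x))^{-1}\right)$.
   Context: $\mathbb{P}=\mu$. For $B\subset X$, $\tau_B(y)=\min\{j>0:T^jy\in B\}\in\mathbb{N}\cup\{\infty\}$. $\mathcal{A}^k=\bigvee_{j=0}^{k-1}T^{-j}\mathcal{A}$; its elements are called $k$-cylinders, and $\operatorname{diam}(\mathcal{A}^k)$ is the supremum of the diameters of its elements. $\mu$ is $\alpha$-mixing with respect to $\mathcal{A}$ if $|\mu(A\cap T^{-n-k}B)-\mu(A)\mu(B)|\le\alpha(k)$ for all $n,k$, all $A\in\sigma(\mathcal{A}^n)$ and all $B\in\sigma(\bigcup_j\mathcal{A}^j)$, where $\alpha(k)$ is a decreasing function converging to $0$ as $k\to\infty$. Here $\alpha^{-1}(u)=\min\{k:\alpha(k)\le u\}$. $B(x,r)$ is the ball of radius $r$ about $x$, and for $0<\delta<\epsilon$, $$\varphi(\epsilon,\delta,x)=\frac{\mu(B(x,\epsilon+\delta))-\mu(B(x,\epsilon-\delta))}{\mu(B(x,\epsilon))}.$$ Bowen ball: $B_{\epsilon,n}(x)=\{y:\sup_{0\le k\le n-1}d(T^kx,T^ky)<\epsilon\}$. $\widetilde B_{\epsilon,n}(x)$ denotes the union of all $N(n)$-cylinders $D\in\mathcal{A}^{N(n)}$ with $D\subset B_{\epsilon,n}(x)$. The constants $C,C_5,C_6$ do not depend on $n,x,t,f$. Statements are understood for those $x,n$ for which the quantities involved are well defined (sets in denominators have positive measure, etc.). *)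

(* Defs.v *)
From HB Require Import structures.
From mathcomp Require Import all_boot all_order all_algebra.
From mathcomp Require Import all_classical all_reals all_analysis.

Set Implicit Arguments.
Unset Strict Implicit.
Unset Printing Implicit Defensive.
Import Order.TTheory GRing.Theory Num.Theory.
Import numFieldNormedType.Exports.

Local Open Scope classical_set_scope.
Local Open Scope ring_scope.

(* Measurable types of the library are pointed.  This costs no generality: a
   space carrying a probability measure is nonempty. *)
#[short(type="pointedMetricType")]
HB.structure Definition PointedMetric (R : numDomainType) :=
  {M of Metric R M & isPointed M}.

Definition borel (R : realType) (X : pointedMetricType R) :=
  g_sigma_algebraType (@open X).

Section Defs.
Variables (R : realType) (X : pointedMetricType R).
Implicit Types (T : X -> X) (mu : probability (borel X) R).
Implicit Types (A : set (set X)) (alpha : nat -> R) (x : X) (B : set X).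

Definition pr mu B : R := fine (mu B).

Definition invariant_measure mu T : Prop :=
  forall B, measurable (B : set (borel X)) -> mu (T @^-1` B) = mu B.

(* The join of A, T^-1 A, ..., T^-(k-1) A; empty intersections are discarded so
   that it is again a partition. *)
Definition cylinders T A (k : nat) : set (set X) :=
  [set D | D !=set0 /\ exists a : nat -> set X,
    (forall j, (j < k)%N -> A (a j)) /\
    D = \bigcap_(j in `I_k) (iter j T @^-1` a j)].

Definition sigma_cyl T A (k : nat) : set (set X) := <<s cylinders T A k >>.

Definition sigma_cyl_all T A : set (set X) :=
  <<s \bigcup_k cylinders T A k >>.

Definition measurable_partition A : Prop :=
  [/\ countable A, partition A id [set: X] &
      forall E, A E -> measurable (E : set (borel X))].

(* One-sided generator, modulo null sets. *)
Definition generating mu T A : Prop :=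
  forall E, measurable (E : set (borel X)) ->
    exists2 F, sigma_cyl_all T A F & mu (E `+` F) = 0%E.

Definition alpha_mixing mu T A alpha : Prop :=
  [/\ {homo alpha : j k / (j <= k)%N >-> k <= j},
      alpha @ \oo --> (0 : R) &
      forall (n k : nat) (E F : set X),
        sigma_cyl T A n E -> sigma_cyl_all T A F ->
        `|pr mu (E `&` iter (n + k) T @^-1` F) - pr mu E * pr mu F|
          <= alpha k].

(* min {k | alpha k <= u}; the default 0 is only used when this set is empty,
   which cannot happen if u > 0 and alpha tends to 0. *)
Definition alpha_inv alpha (u : R) : nat :=
  if pselect (exists k, alpha k <= u) is left e then ex_minn e else 0%N.

(* In a compact space the suprema below are over bounded sets. *)
Definition diam B : R := sup [set mdist y z | y in B & z in B].

Definition diam_cyl T A (k : nat) : R := sup [set diam D | D in cylinders T A k].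

Definition phi mu (eps delta : R) x : R :=
  (pr mu (ball x (eps + delta)) - pr mu (ball x (eps - delta)))
  / pr mu (ball x eps).

(* The supremum is a maximum of nonnegative terms. *)
Definition bowen T (eps : R) (n : nat) x : set X :=
  [set y | \big[Order.max/0]_(k < n) mdist (iter k T x) (iter k T y) < eps].

Definition bowen_inner T A (N : nat -> nat) (eps : R) (n : nat) x : set X :=
  \bigcup_(D in [set D | cylinders T A (N n) D /\ D `<=` bowen T eps n x]) D.

(* Minimum over the positive entry times, with value +oo if there are none. *)
Definition tau T B (y : X) : \bar R :=
  ereal_inf [set j%:R%:E | j in [set j : nat | (0 < j)%N /\ B (iter j T y)]].

Definition spread mu T A alpha (N : nat -> nat) (C' eps : R) (n : nat) x : nat :=
  (alpha_inv alpha (C' * pr mu (bowen_inner T A N eps n x)) + N n)%N.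

End Defs.

(* Main.v *)
Require Import Defs.
From HB Require Import structures.
From mathcomp Require Import all_boot all_order all_algebra.
From mathcomp Require Import all_classical all_reals all_analysis.
From mathcomp Require Import zify ring lra.

Set Implicit Arguments.
Unset Strict Implicit.
Unset Printing Implicit Defensive.
Import Order.TTheory GRing.Theory Num.Theory.
Import numFieldNormedType.Exports.

Local Open Scope classical_set_scope.
Local Open Scope ring_scope.

(** Why the theorem holds.

Fix eps, n, x and write B for the Bowen ball, U for the union of the
N(n)-cylinders inside B, m = mu(B), u = mu(U) and p_j for the probability of
avoiding U at the times 1, ..., j.

Passing from B to U.  A point of B outside U has, at some time k < n, a
companion in its (N(n) - k)-cylinder that leaves the eps-ball about T^k x; so
T^k of the point lies in the annulus of width gamma_(N(n)-k) inside the sphere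
of radius eps.  By invariance and the annulus hypothesis,
m - u <= theta m / s ([pr_bowen_sub_inner]).  As an orbit must visit B minus U
for the two avoidance events to differ, replacing B by U up to time t/(lambda m)
costs at most theta t / (s lambda), the first error term ([pr_avoid_mono]).

Loss of memory.  U depends on N(n) coordinates.  Opening a gap of 2 N(n) times
inside a block, half of it for the coordinates of U and half for mixing, gives
|p_(F+b) - p_F p_b| <= 2 N(n) u + alpha(N(n)) =: e for every F >= 2 N(n)
([pr_avoid_almost_mul]).  Iterating, p_(jF) is within e / (1 - p_F) of p_F^j,
because the errors of earlier blocks are damped by the factor p_F
([approx_geometric]).

Short returns.  The quotient e / (1 - p_F) is useful only if visits before time
F are not too rare.  Looking at the orbit at multiples of s only, where
s - N(n) = alpha^(-1)(C' u), each observation produces a first visit with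
probability at least u (P(no visit so far) - C'), which gives
1 - p_F >= c F u / s with c = (1 - C') / 4 ([block_visit_lower]).  This is where
the factor s of the error terms comes from.

The exponential law.  With the rate lambda m = - ln(p_F) / F, comparison of
floor(t / (lambda m)) with a multiple of F yields an error of order
F m + K / F, where K = s N(n) + s alpha(N(n)) / u ([block_law]).  The
rate depends on the block length F, whereas one lambda has to serve every f.
Hence F is taken near the minimiser sqrt(K/m) of that error: the result,
a multiple of sqrt(K m), is below 2 f m + C5 K / f for every f by the inequality
of arithmetic and geometric means ([tradeoff_lower_bound]).

Two degenerate regimes are settled by crude bounds: K m >= 1/64, where the error
terms exceed 1, and theta / s >= 3/4, where u may be much smaller than m but
the trivial lower bound 1 - j m for the probability of avoiding B up to time j
is good enough ([exp_crude_bound]). *)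

(** * Sequences that are almost multiplicative *)

Section RealSequences.
Variable R : realType.
Implicit Types (p q : nat -> R) (c e u t x y : R).

(** The error committed at step [k] is multiplied by [x] at every later step, so
    that all errors together stay below a geometric series. *)
Lemma approx_geometric q x e : q 0 = 1 -> 0 <= x < 1 ->
  (forall k, `|q k.+1 - x * q k| <= e) ->
  forall k, `|q k - x ^+ k| <= e / (1 - x).
Proof.
move=> q0 /andP[x0 x1] qS; elim=> [|k IH].
  rewrite q0 expr0 subrr normr0 divr_ge0 ?subr_ge0 ?(ltW x1)//.
  exact: le_trans (normr_ge0 _) (qS 0).
have -> : q k.+1 - x ^+ k.+1 = (q k.+1 - x * q k) + x * (q k - x ^+ k).
  by rewrite exprS; ring.
apply: le_trans (ler_normD _ _) _; rewrite normrM (ger0_norm x0).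
have -> : e / (1 - x) = e + x * (e / (1 - x)) by field; rewrite gt_eqF// subr_gt0.
by rewrite lerD// ler_wpM2l.
Qed.

(** The recursion contracts [q - c] by the factor [1 - u]; Bernoulli's inequality
    in the form (1 - u)^k (1 + k u) <= 1 makes the decay of [q] linear in [k] up
    to time [1 / u]. *)
Lemma contraction_lower_bound q c u : q 0 = 1 -> c <= 1 -> 0 <= u <= 1 ->
  (forall k, q k.+1 <= q k - u * (q k - c)) ->
  forall k, k%:R * u <= 1 -> (1 - c) / 2 * (k%:R * u) <= 1 - q k.
Proof.
move=> q0 c1 /andP[u0 u1] qS.
have qc k : q k - c <= (1 - c) * (1 - u) ^+ k.
  elim: k => [|k IH]; first by rewrite q0 expr0 mulr1.
  have h : (1 - u) * (q k - c) <= (1 - u) * ((1 - c) * (1 - u) ^+ k).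
    by rewrite ler_wpM2l ?subr_ge0.
  by rewrite exprS; have := qS k; lra.
have bern k : (1 - u) ^+ k * (1 + k%:R * u) <= 1.
  elim: k => [|k IH]; first by rewrite expr0 mul0r addr0 mulr1.
  apply: le_trans IH; rewrite exprSr -mulrA ler_wpM2l ?exprn_ge0 ?subr_ge0//.
  have k0 : 0 <= k%:R :> R by exact: ler0n.
  by rewrite -natr1; nra.
move=> k ku1; have k0 : 0 <= k%:R * u by rewrite mulr_ge0.
have w0 : 0 <= (1 - u) ^+ k by rewrite exprn_ge0 ?subr_ge0.
have := qc k; have := bern k.
set w := (1 - u) ^+ k in w0 *; set a := k%:R * u in ku1 k0 *; move=> wa qw.
(* [w <= 1 / (1 + a)], and [1 / (1 + a) <= 1 - a / 2] for [0 <= a <= 1]. *)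
have : w <= 1 - a / 2 by nra.
have c0 : 0 <= 1 - c by lra.
by nra.
Qed.

Section Survival.
Variables (p : nat -> R) (u e : R) (F : nat).
Hypotheses (p0 : p 0 = 1) (p_decr : forall a, p a.+1 <= p a)
  (p_step : forall a, p a - u <= p a.+1).

Lemma survival_lower a b : p a - b%:R * u <= p (a + b)%N.
Proof.
elim: b => [|b IH]; first by rewrite addn0 mul0r subr0.
by rewrite addnS -natr1; have := p_step (a + b); lra.
Qed.

Lemma survival_nonincr a b : p (a + b)%N <= p a.
Proof.
by elim: b => [|b IH]; rewrite ?addn0// addnS; apply: le_trans (p_decr _) IH.
Qed.

Hypotheses (F0 : (0 < F)%N) (pF : 0 < p F < 1)
  (pF_mul : forall b, `|p (F + b)%N - p F * p b| <= e).

(** Cut the time axis into blocks of length [F].  Rounding the time down to a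
    multiple of [F] costs [F%:R * u] for the survival function and the same for
    the exponential; between the two stands the geometric approximation over
    whole blocks. *)
Lemma survival_exponential r : 0 <= r ->
  `|p (Num.truncn r) - expR (r * (ln (p F) / F%:R))|
    <= 2 * (F%:R * u) + e / (1 - p F).
Proof.
move=> r0; case/andP: pF => pF0 pF1.
have FR : 0 < F%:R :> R by rewrite ltr0n.
have /andP[rl ru] := truncn_itv r0.
set M := Num.truncn r in rl ru *; set k := (M %/ F)%N.
have ME : M = (k * F + M %% F)%N by exact: divn_eq.
have Mk : p (k * F)%N - F%:R * u <= p M <= p (k * F)%N.
  have u0 : 0 <= u by have := p_decr 0; have := p_step 0; lra.
  have -> : p M = p (k * F + M %% F)%N by rewrite -ME.
  rewrite survival_nonincr andbT; apply: le_trans (survival_lower _ _).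
  by rewrite lerD2l lerN2 ler_wpM2r// ler_nat ltnW// ltn_pmod.
have geo : `|p (k * F)%N - p F ^+ k| <= e / (1 - p F).
  apply: (@approx_geometric (fun k => p (k * F)%N)) => [||j].
  - by rewrite mul0n p0.
  - by rewrite (ltW pF0).
  - by rewrite mulSn.
have lnF : ln (p F) <= 0 by rewrite ln_le0 ?ltW.
have eF j : expR ((j * F)%:R * (ln (p F) / F%:R)) = p F ^+ j.
  rewrite natrM -mulrA [F%:R * _]mulrC divfK ?gt_eqF// expRM_natl lnK//;
  exact: pF0.
(* The exponential at time [r] lies between the powers [k] and [k.+1] of [p F]. *)
have ex1 : expR (r * (ln (p F) / F%:R)) <= p F ^+ k.
  rewrite -eF ler_expR; apply: ler_wnM2r.
    by rewrite pmulr_lle0 ?invr_gt0.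
  by apply: le_trans rl; rewrite ler_nat leq_divM.
have ex2 : p F ^+ k.+1 <= expR (r * (ln (p F) / F%:R)).
  rewrite -eF ler_expR; apply: ler_wnM2r.
    by rewrite pmulr_lle0 ?invr_gt0.
  by apply: ltW; apply: lt_le_trans ru _; rewrite ler_nat ltn_ceil.
have drop : p F ^+ k - p F ^+ k.+1 <= F%:R * u.
  have pk : p F ^+ k <= 1 by rewrite exprn_ile1 ?ltW.
  have pk0 : 0 <= p F ^+ k by rewrite exprn_ge0 ?ltW.
  have := survival_lower 0 F; rewrite p0 add0n exprS; nra.
by move: geo Mk; rewrite !ler_norml => /andP[? ?] /andP[? ?]; lra.
Qed.

(** The logarithm lies below its tangent at 1, both at [p F] and at its inverse. *)
Lemma survival_rate : 1 - p F <= - ln (p F) <= (1 - p F) / p F.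
Proof.
case/andP: pF => pF0 pF1.
have pN : p F = 1 + (p F - 1) by lra.
have pV : (p F)^-1 = 1 + (1 - p F) / p F by field; rewrite gt_eqF.
apply/andP; split.
  have : ln (p F) <= p F - 1 by rewrite {1}pN le_ln1Dx//; lra.
  by lra.
rewrite -lnV ?posrE// {1}pV le_ln1Dx//.
by apply: lt_le_trans (_ : 0 <= _) => //; rewrite divr_ge0//; lra.
Qed.

End Survival.
End RealSequences.

(** * Sets determined by finitely many symbols *)

Section Cylinders.
Variables (R : realType) (X : pointedMetricType R) (T : X -> X).
Variable A : set (set X).
Implicit Types (E F D : set X) (k m n : nat) (y z : X).

Definition same_itinerary k y z :=
  forall j, (j < k)%N -> forall a, A a -> a (iter j T y) <-> a (iter j T z).

(** Saturation under equality of the first [k] symbols.  Saturated sets are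
    stable under Boolean operations, so that membership of a set in the
    sigma-algebra of the [k]-cylinders need not be derived from the way the set is
    built, see [sigma_cyl_determined]. *)
Definition determined k E := forall y z, same_itinerary k y z -> E y <-> E z.

Lemma same_itineraryW k m y z : (k <= m)%N ->
  same_itinerary m y z -> same_itinerary k y z.
Proof. by move=> km yz j jk; apply: yz; exact: leq_trans km. Qed.

Lemma same_itinerary_iter k j y z :
  same_itinerary (j + k) y z -> same_itinerary k (iter j T y) (iter j T z).
Proof. by move=> yz i ik; rewrite -!iterD; apply: yz; rewrite addnC ltn_add2l. Qed.

Lemma determined_le k m E : (k <= m)%N -> determined k E -> determined m E.
Proof. by move=> km dE y z yz; apply: dE; exact: same_itineraryW yz. Qed.

Lemma determinedC k E : determined k E -> determined k (~` E).
Proof.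
by move=> dE y z yz; have [? ?] := dE _ _ yz; split=> /= nE ?; apply: nE; auto.
Qed.

Lemma determinedI k E F :
  determined k E -> determined k F -> determined k (E `&` F).
Proof.
by move=> dE dF y z yz; have [? ?] := dE _ _ yz; have [? ?] := dF _ _ yz;
  split=> -[]; split; auto.
Qed.

Hypothesis Apart : measurable_partition A.

Let Acover y : exists2 a, A a & a y.
Proof.
case: Apart => _ [cov _ _] _.
have [a Aa ay] : cover A id y by rewrite cov.
by exists a.
Qed.

Let Adisj a b y : A a -> A b -> a y -> b y -> a = b.
Proof. by case: Apart => _ [_ tri _] _ Aa Ab ay b_y; apply: tri => //; exists y. Qed.

(** As the atoms are disjoint, a nonempty cylinder is the class of any of its
    points. *)
Lemma cylinder_same_itinerary k D y z : cylinders T A k D -> D y ->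
  D z <-> same_itinerary k y z.
Proof.
move=> [_ [a [Aa ->]]] Dy; split=> [Dz j jk b Ab|yz j /= jk].
  have aj := Aa j jk; have [ay az] := (Dy j jk, Dz j jk).
  by split=> b_; [rewrite (Adisj Ab aj b_ ay)|rewrite (Adisj Ab aj b_ az)].
by apply/(yz j jk (a j)); [exact: Aa | exact: Dy].
Qed.

Lemma exists_cylinder k y : exists2 D, cylinders T A k D & D y.
Proof.
have /choice[a aP] : forall j, exists a, A a /\ a (iter j T y).
  by move=> j; have [a Aa ay] := Acover (iter j T y); exists a.
have Dy : (\bigcap_(j in `I_k) (iter j T @^-1` a j)) y.
  by move=> j _ /=; case: (aP j).
exists (\bigcap_(j in `I_k) (iter j T @^-1` a j)) => //.
by split; [exists y | exists a; split=> // j _; case: (aP j)].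
Qed.

(** A [k.+1]-cylinder is cut out of a [k]-cylinder by one atom, and there are
    countably many atoms. *)
Lemma countable_cylinders k : countable (cylinders T A k).
Proof.
have [cA _ _] := Apart.
elim: k => [|k IH].
  apply: sub_countable (countable1 [set: X]); apply: subset_card_le.
  move=> D [_ [a [_ ->]]] /=; by apply/seteqP; split=> // y _ j.
have cI := countableX IH cA.
pose f (E : set X * set X) := E.1 `&` iter k T @^-1` E.2.
apply: sub_countable (sub_countable (card_image_le f _) cI).
apply: subset_card_le => D [[y Dy] [a [Aa DE]]].
exists (\bigcap_(j in `I_k) (iter j T @^-1` a j), a k) => /=.
  split; last exact: Aa.
  split; last by exists a; split=> // j jk; apply: Aa; exact: ltnW.
  by exists y; move: Dy; rewrite DE => Dy j jk; apply: Dy; exact: ltnW.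
rewrite DE; apply/seteqP; split=> [z [zk za] j|z zD] /=.
  by rewrite ltnS leq_eqVlt => /predU1P[->//|]; exact: zk.
by split=> [j /= jk|]; apply: zD => //=; exact: ltnW.
Qed.

Lemma sigma_algebra_countable_union (G C : set (set X)) :
  countable C -> C `<=` <<s G >> -> <<s G >> (\bigcup_(D in C) D).
Proof.
move=> cC CG.
have /countable_injP[f finj] := cC.
(* Index [C] by an injection into [nat]; [S i] is empty if [i] is not a code. *)
pose S i := \bigcup_(D in [set D | C D /\ f D = i]) D.
have -> : \bigcup_(D in C) D = \bigcup_i S i.
  apply/seteqP; split=> [y [D CD Dy]|y [i _ [D [CD _] Dy]]]; last by exists D.
  by exists (f D) => //; exists D.
apply: sigma_algebra_bigcup => i.
have [[D [CD fD]]|nD] := pselect (exists D, C D /\ f D = i); last first.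
  suff -> : S i = set0 by exact: sigma_algebra0.
  by apply/seteqP; split=> // y [D CfD _]; apply: nD; exists D.
suff -> : S i = D by exact: CG.
apply/seteqP; split=> [y [D' [CD' fD'] D'y]|y Dy]; last by exists D.
by rewrite (finj D D') ?inE// fD.
Qed.

(** A saturated set is the union of the cylinders it contains, and this union is
    countable. *)
Lemma sigma_cyl_determined k E : determined k E -> sigma_cyl T A k E.
Proof.
move=> dE.
have -> : E = \bigcup_(D in [set D | cylinders T A k D /\ D `<=` E]) D.
  apply/seteqP; split=> [y Ey|y [D [_ DE] Dy]]; last exact: DE.
  have [D cD Dy] := exists_cylinder k y.
  exists D => //; split=> // z Dz.
  by apply/(dE y z) => //; apply/(cylinder_same_itinerary z cD Dy).
apply: sigma_algebra_countable_union => [|D [cD _]].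
  apply: sub_countable (countable_cylinders k).
  by apply: subset_card_le => D [].
exact: sub_sigma_algebra.
Qed.

Lemma sigma_cyl_all_determined k E : determined k E -> sigma_cyl_all T A E.
Proof.
move=> /sigma_cyl_determined; apply: sub_sigma_algebra2 => D cD.
by exists k.
Qed.

Lemma determined_cylinder_union k (B : set X) :
  determined k (\bigcup_(D in [set D | cylinders T A k D /\ D `<=` B]) D).
Proof.
move=> y z yz; split=> -[D [cD DB] Dy]; exists D => //.
  by apply/(cylinder_same_itinerary z cD Dy).
apply/(cylinder_same_itinerary y cD Dy) => j jk a Aa.
by apply: iff_sym; exact: yz.
Qed.

Section Measurability.
Hypothesis Tcont : continuous T.

Lemma open_borel (B : set X) : open B -> measurable (B : set (borel X)).
Proof. exact: sub_sigma_algebra. Qed.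

Lemma continuous_iter k : continuous (iter k T).
Proof.
elim: k => [|k IH] y; first exact: cvg_id.
by apply: (@continuous_comp _ _ _ (iter k T) T); [exact: IH | exact: Tcont].
Qed.

Lemma measurable_preimage_continuous (f : X -> X) (B : set X) : continuous f ->
  measurable (B : set (borel X)) -> measurable (f @^-1` B : set (borel X)).
Proof.
move=> fcont mB.
suff mf : measurable_fun setT (f : borel X -> borel X).
  by rewrite -[X in measurable X]setTI; exact: mf.
apply: (@measurability _ _ (borel X) (borel X) setT f (@open X)) => // _ [V oV <-].
by rewrite setTI; apply: open_borel; move/continuousP: fcont; exact.
Qed.

Lemma measurable_preimage_iter k (B : set X) :
  measurable (B : set (borel X)) -> measurable (iter k T @^-1` B : set (borel X)).
Proof. by apply: measurable_preimage_continuous; exact: continuous_iter. Qed.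

Lemma measurable_determined k E :
  determined k E -> measurable (E : set (borel X)).
Proof.
move=> /sigma_cyl_determined; apply: smallest_sub.
  exact: (@sigma_algebra_measurable _ (borel X)).
move=> D [_ [a [Aa ->]]]; have [_ _ mA] := Apart.
rewrite bigcap_mkcond; apply: bigcapT_measurable => j.
case: ifPn => // jk; apply: measurable_preimage_iter; apply: mA; apply: Aa.
by move: jk; rewrite inE.
Qed.

End Measurability.
End Cylinders.

(** * Avoiding a set: invariance *)

Section RealValuedProbability.
Variables (R : realType) (X : pointedMetricType R).
Variable mu : probability (borel X) R.
Implicit Types E F : set X.
Local Notation mset E := (measurable (E : set (borel X))).

Lemma prE E : mset E -> mu E = (pr mu E)%:E.
Proof. by move=> mE; rewrite /pr fineK// fin_num_measure. Qed.

Lemma pr_ge0 E : 0 <= pr mu E.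
Proof. exact: fine_ge0. Qed.

Lemma pr_le E F : mset E -> mset F -> E `<=` F -> pr mu E <= pr mu F.
Proof.
by move=> mE mF EF; rewrite -lee_fin -!prE// le_measure ?inE.
Qed.

Lemma pr_setT : pr mu [set: X] = 1.
Proof. by rewrite /pr probability_setT. Qed.

Lemma pr_le1 E : mset E -> pr mu E <= 1.
Proof. by move=> mE; rewrite -pr_setT pr_le//; exact: measurableT. Qed.

Lemma pr_setID E F : mset E -> mset F ->
  pr mu E = pr mu (E `&` F) + pr mu (E `\` F).
Proof.
move=> mE mF; apply/EFin_inj; rewrite EFinD -!prE//.
- by rewrite addeC; exact: measureDI.
- exact: measurableD.
- exact: measurableI.
Qed.

Lemma pr_setC E : mset E -> pr mu (~` E) = 1 - pr mu E.
Proof.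
by move=> mE; have := pr_setID measurableT mE; rewrite setTI setTD pr_setT; lra.
Qed.

Lemma pr_setDS E F : mset E -> mset F -> F `<=` E ->
  pr mu (E `\` F) = pr mu E - pr mu F.
Proof. by move=> mE mF FE; rewrite (pr_setID mE mF) (setIidr FE); lra. Qed.

Lemma pr_setU_le E F : mset E -> mset F -> pr mu (E `|` F) <= pr mu E + pr mu F.
Proof.
move=> mE mF; rewrite -lee_fin EFinD -!prE//; last exact: measurableU.
exact: measureU2.
Qed.

Lemma pr_bigsetU_le n (E : nat -> set X) : (forall k, mset (E k)) ->
  pr mu (\big[setU/set0]_(k < n) E k) <= \sum_(k < n) pr mu (E k).
Proof.
move=> mE; elim: n => [|n IH]; first by rewrite !big_ord0 /pr measure0.
rewrite !big_ord_recr /=; apply: le_trans (pr_setU_le _ (mE n)) _.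
  exact: (@bigsetU_measurable _ (borel X)).
by rewrite lerD2r.
Qed.

End RealValuedProbability.

Section Avoidance.
Variables (X : Type) (T : X -> X).
Implicit Types E F : set X.

(** With [iter d T] for [T] the orbit is observed at the multiples of [d] only. *)
Definition avoid E m : set X :=
  [set y | forall j, (0 < j <= m)%N -> ~ E (iter j T y)].

Lemma avoid0 E : avoid E 0 = [set: X].
Proof. by apply/seteqP; split=> // y _ [|j]. Qed.

Lemma avoidD E a b : avoid E (a + b) = avoid E a `&` iter a T @^-1` avoid E b.
Proof.
apply/seteqP; split=> [y Ey|y [Ea Eb] j /andP[j0 jab]].
  split=> [j /andP[j0 ja]|j /andP[j0 jb]] /=.
    by apply: Ey; rewrite j0 (leq_trans ja)// leq_addr.
  by rewrite -iterD; apply: Ey; rewrite addn_gt0 j0 addnC leq_add2l.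
have [ja|aj] := leqP j a; first by apply: Ea; rewrite j0.
rewrite -(subnK (ltnW aj)) iterD; apply: Eb.
by rewrite subn_gt0 aj leq_subLR.
Qed.

(** Reading the first [m.+1] times from time 1 on: this turns the loss of
    probability at time [m.+1] into a probability of visiting at time 0, see
    [pr_avoidS]. *)
Lemma avoidS E m : avoid E m.+1 = T @^-1` (avoid E m `\` E).
Proof.
rewrite -add1n avoidD; apply/seteqP; split=> [y [E1 Em]|y [Em E1]]; split=> //.
  by apply: (E1 1%N).
by move=> j; rewrite andbC -eqn_leq => /eqP ->.
Qed.

Lemma avoid_subset E F m : E `<=` F -> avoid F m `<=` avoid E m.
Proof. by move=> EF y Fy j jm /EF; exact: Fy. Qed.

End Avoidance.

Lemma avoid_iter (X : Type) (T : X -> X) (E : set X) d q m : (q * d <= m)%N ->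
  (0 < d)%N -> avoid T E m `<=` avoid (iter d T) E q.
Proof.
move=> qdm d0 y Ey j /andP[j0 jq]; rewrite -iterM; apply: Ey.
by rewrite muln_gt0 j0 d0 (leq_trans _ qdm)// leq_mul2r jq orbT.
Qed.

Section AvoidanceProbability.
Variables (R : realType) (X : pointedMetricType R) (T : X -> X).
Variable mu : probability (borel X) R.
Hypotheses (Tcont : continuous T) (Tinv : invariant_measure mu T).
Implicit Types E F : set X.
Local Notation mset E := (measurable (E : set (borel X))).

Lemma invariant_measure_iter k : invariant_measure mu (iter k T).
Proof.
elim: k => [//|k IH] E mE.
rewrite (_ : iter k.+1 T @^-1` E = iter k T @^-1` (T @^-1` E))//.
by rewrite IH ?Tinv//; exact: measurable_preimage_continuous.
Qed.

Lemma pr_preimage_iter k E : mset E -> pr mu (iter k T @^-1` E) = pr mu E.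
Proof. by move=> mE; rewrite /pr invariant_measure_iter. Qed.

Lemma measurable_avoid E m : mset E -> mset (avoid T E m).
Proof.
move=> mE; elim: m => [|m IH]; first by rewrite avoid0; exact: measurableT.
by rewrite avoidS; apply: measurable_preimage_continuous => //; exact: measurableD.
Qed.

(** A first visit at time [m.+1] has, by invariance, the probability of a visit
    at time 0 followed by [m] times without a visit. *)
Lemma pr_avoidS E m : mset E ->
  pr mu (avoid T E m.+1) = pr mu (avoid T E m) - pr mu (E `&` avoid T E m).
Proof.
move=> mE; have mW := measurable_avoid m mE.
rewrite avoidS (@pr_preimage_iter 1); last exact: measurableD.
by have := pr_setID mu mW mE; rewrite setIC; lra.
Qed.

Lemma pr_avoidS_le E m : mset E ->
  pr mu (avoid T E m.+1) <= pr mu (avoid T E m).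
Proof. by move=> mE; rewrite pr_avoidS// gerBl pr_ge0. Qed.

Lemma pr_avoidS_ge E m : mset E ->
  pr mu (avoid T E m) - pr mu E <= pr mu (avoid T E m.+1).
Proof.
move=> mE; rewrite pr_avoidS// lerD2l lerN2 pr_le//.
by apply: measurableI => //; exact: measurable_avoid.
Qed.

(** An orbit that avoids [E] but not [F] visits [F] minus [E], which has [m]
    occasions to happen. *)
Lemma pr_avoid_mono E F m : mset E -> mset F -> E `<=` F ->
  0 <= pr mu (avoid T E m) - pr mu (avoid T F m) <= m%:R * pr mu (F `\` E).
Proof.
move=> mE mF EF.
have [mWE mWF] : mset (avoid T E m) /\ mset (avoid T F m).
  by split; exact: measurable_avoid.
apply/andP; split; first by rewrite subr_ge0 pr_le//; exact: avoid_subset.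
have mFE : mset (F `\` E) by exact: measurableD.
rewrite lerBlDl.
apply: le_trans (_ : pr mu (avoid T F m `|` ~` avoid T (F `\` E) m) <= _).
  apply: pr_le => //.
    by apply: measurableU => //; apply: measurableC; exact: measurable_avoid.
  move=> y Ey; have [|nFE] := pselect (avoid T (F `\` E) m y); last by right.
  move=> FEy; left=> j jm Fj; apply: (FEy j jm); split=> //.
  exact: (Ey j jm).
apply: le_trans (pr_setU_le _ _ _) _ => //.
  by apply: measurableC; exact: measurable_avoid.
rewrite lerD2l pr_setC; last exact: measurable_avoid.
have := @survival_lower R (fun a => pr mu (avoid T (F `\` E) a)) (pr mu (F `\` E))
  (fun a => pr_avoidS_ge a mFE) 0 m.
by rewrite add0n avoid0 pr_setT; lra.
Qed.

End AvoidanceProbability.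

Section Tau.
Variables (R : realType) (X : pointedMetricType R) (T : X -> X).

(** Entry times are integers, so a real threshold can be rounded down. *)
Lemma tau_gt (E : set X) (r : R) : 0 <= r ->
  [set y | (r%:E < tau T E y)%E] = avoid T E (Num.truncn r).
Proof.
move=> r0; apply/seteqP; split=> y /=.
  move=> ry j /andP[j0 jr] Ej; move: ry; apply/negP; rewrite -leNgt.
  apply: le_trans (_ : (j%:R%:E <= _)%E); last first.
    by rewrite lee_fin -truncn_ge_nat.
  by apply: ereal_inf_lbound; exists j.
move=> Ey; apply: lt_le_trans (_ : ((Num.truncn r).+1%:R%:E <= _)%E).
  by rewrite lte_fin truncnS_gt.
apply: le_ereal_inf_tmp => _ [j [j0 Ej] <-]; rewrite lee_fin ler_nat ltnNge.
by apply/negP => jr; apply: (Ey j) => //; rewrite j0.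
Qed.

End Tau.

(** * Avoiding a set: mixing *)

Section Mixing.
Variables (R : realType) (X : pointedMetricType R) (T : X -> X).
Variables (mu : probability (borel X) R) (A : set (set X)) (alpha : nat -> R).
Hypotheses (Tcont : continuous T) (Tinv : invariant_measure mu T).
Hypotheses (Apart : measurable_partition A) (mix : alpha_mixing mu T A alpha).
Implicit Types (E F : set X) (N k : nat).
Local Notation mset E := (measurable (E : set (borel X))).

Lemma mixing_determined n k m E F :
  determined T A n E -> determined T A m F ->
  `|pr mu (E `&` iter (n + k) T @^-1` F) - pr mu E * pr mu F| <= alpha k.
Proof.
move=> dE dF; case: mix => _ _; apply; first exact: sigma_cyl_determined.
exact: sigma_cyl_all_determined dF.
Qed.

Lemma alpha_ge0 k : 0 <= alpha k.
Proof.
have dT : determined T A 0 [set: X] by [].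
exact: le_trans (normr_ge0 _) (mixing_determined k dT dT).
Qed.

Lemma alpha_invP c : 0 < c -> alpha (alpha_inv alpha c) <= c.
Proof.
move=> c0; rewrite /alpha_inv; case: pselect => [e|]; first by case: ex_minnP.
case: mix => _ /cvgrPdist_le /(_ c c0) [k _ ak] _ []; exists k.
have := ak k (leqnn k); rewrite sub0r normrN.
exact: le_trans (ler_norm _).
Qed.

Lemma determined_avoid N d q E : determined T A N E ->
  determined T A (q * d + N) (avoid (iter d T) E q).
Proof.
move=> dE y z yz; suff h j : (0 < j <= q)%N ->
    E (iter j (iter d T) y) <-> E (iter j (iter d T) z).
  by split=> W j jq => [/(h _ jq)|/(h _ jq)]; exact: W.
move=> /andP[j0 jq]; rewrite -!iterM; apply: dE; apply: same_itinerary_iter.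
by apply: same_itineraryW yz; rewrite leq_add2r leq_mul2r jq orbT.
Qed.

Section Visits.
Variables (N : nat) (E : set X).
Hypothesis dE : determined T A N E.

Let mE : mset E.
Proof. exact: measurable_determined dE. Qed.

Let u := pr mu E.
Let p m := pr mu (avoid T E m).

(** Stop observing [2 * N] times before the end of the first block.  What was
    seen until then is determined by coordinates that end [N] times before the
    second block starts, so mixing decouples the two; a visit inside the gap has
    probability at most [2 * N * u]. *)
Lemma pr_avoid_almost_mul a b : (2 * N <= a)%N ->
  `|p (a + b) - p a * p b| <= 2 * N%:R * u + alpha N.
Proof.
move=> Na; pose a' := (a - 2 * N)%N.
have aE : a = (a' + 2 * N)%N by rewrite subnK.
have aE' : a = (a' + N + N)%N by rewrite aE; lia.
have mW m : mset (avoid T E m) by exact: measurable_avoid.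
have pa : p a' - 2 * N%:R * u <= p a <= p a'.
  rewrite aE -natrM; apply/andP; split.
    by apply: survival_lower => m; exact: pr_avoidS_ge.
  by apply: survival_nonincr => m; exact: pr_avoidS_le.
(* [V] allows visits in the gap between [a'] and [a]. *)
pose V := avoid T E a' `&` iter a T @^-1` avoid T E b.
have mV : mset V by apply: measurableI => //; exact: measurable_preimage_iter.
have Vab : p (a + b) <= pr mu V <= p (a + b) + (p a' - p a).
  have sub1 : avoid T E (a + b) `<=` V.
    rewrite avoidD => y [Wa Wb]; split=> // j /andP[j0 ja].
    by apply: Wa; rewrite j0 (leq_trans ja)// aE leq_addr.
  rewrite pr_le//=.
  have Wa'a : avoid T E a `<=` avoid T E a'.
    by rewrite aE avoidD => y [].
  rewrite -(pr_setDS mu _ _ Wa'a)//.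
  apply: le_trans (pr_setU_le _ _ _) => //; last exact: measurableD.
  apply: pr_le => //; first by apply: measurableU => //; exact: measurableD.
  move=> y [Wa' Wb]; have [Wa|nWa] := pselect (avoid T E a y); [left|right] => //.
  by rewrite avoidD.
have := mixing_determined N (determined_avoid (d := 1) (q := a') dE)
  (determined_avoid (d := 1) (q := b) dE).
rewrite muln1 -aE' -/V -/(p a') -/(p b) ler_norml => /andP[m1 m2].
have b1 : 0 <= p b <= 1 by rewrite pr_ge0 pr_le1.
have N0 : 0 <= 2 * N%:R * u by rewrite !mulr_ge0// pr_ge0.
rewrite ler_norml; move: pa Vab b1 => /andP[? ?] /andP[? ?] /andP[? ?].
by apply/andP; split; nra.
Qed.

(** Observe the orbit at multiples of [N + k] only.  The gap is such that a visit
    now and no visit at the next [j] observations are independent up to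
    [alpha k <= c * u], an error small relative to [u] itself; so each observation
    is a first visit with probability at least [u * (P - c)], [P] being the
    probability of no visit so far. *)
Lemma pr_visit_lower c k q m : c <= 1 -> alpha k <= c * u ->
  (0 < N + k)%N -> (q * (N + k) <= m)%N -> q%:R * u <= 1 ->
  (1 - c) / 2 * (q%:R * u) <= 1 - p m.
Proof.
move=> c1 ak d0 qm qu.
set G := iter (N + k) T.
have Gcont : continuous G by exact: continuous_iter.
have Ginv : invariant_measure mu G by exact: invariant_measure_iter.
have u01 : 0 <= u <= 1 by rewrite pr_ge0 pr_le1.
apply: le_trans (_ : 1 - pr mu (avoid G E q) <= _); last first.
  rewrite lerD2l lerN2; apply: pr_le.
  - exact: measurable_avoid.
  - exact: measurable_avoid.
  - exact: avoid_iter qm d0.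
apply: (@contraction_lower_bound R (fun j => pr mu (avoid G E j)) c u) => //.
  by rewrite avoid0 pr_setT.
move=> j; rewrite pr_avoidS// lerD2l lerN2.
case: j => [|j].
  rewrite avoid0 setIT pr_setT -/u.
  have : 0 <= c * u by apply: le_trans (alpha_ge0 k) ak.
  by lra.
(* Times are shifted by [N + k], so that mixing applies to an event [V] that
   starts at time 0. *)
pose V := avoid G E j `\` E.
have dV : determined T A (j * (N + k) + N) V.
  apply: determinedI; first exact: determined_avoid.
  by apply: determinedC; apply: determined_le dE; exact: leq_addl.
have pV : pr mu (avoid G E j.+1) = pr mu V.
  by rewrite avoidS (@pr_preimage_iter _ _ _ _ Gcont Ginv 1)//;
    exact: measurable_determined dV.
have := mixing_determined k dE dV.
rewrite -[iter (N + k) T]/G -avoidS -pV ler_norml => /andP[? _].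
by rewrite /u in ak *; nra.
Qed.

End Visits.
End Mixing.

(** * Approximation of Bowen balls by cylinders *)

Section BowenBalls.
Variables (R : realType) (X : pointedMetricType R) (T : X -> X).
Implicit Types (x y z : X) (eps : R).

Lemma open_metric_ball x eps : open (ball x eps).
Proof.
rewrite openE => y xy; apply: (filterS (P := ball y (eps - mdist x y))).
  move=> z; move: xy; rewrite !ballEmdist /= => xy yz.
  by apply: le_lt_trans (metric_triangle x y z) _; lra.
by apply: nbhsx_ballx; move: xy; rewrite ballEmdist /= subr_gt0.
Qed.

Lemma bowenP eps n x y : 0 < eps ->
  bowen T eps n x y <-> forall k, (k < n)%N -> ball (iter k T x) eps (iter k T y).
Proof.
move=> e0; rewrite /bowen /=; split=> [/bigmax_ltP[_ h] k kn|h].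
  by rewrite ballEmdist /=; exact: (h (Ordinal kn)).
apply/bigmax_ltP; split=> // i _; have := h i (ltn_ord i).
by rewrite ballEmdist.
Qed.

Lemma compact_mdist_bounded : compact [set: X] ->
  exists M, forall y z, mdist y z <= M.
Proof.
rewrite compact_cover => /(_ nat setT (fun i => ball (point : X) i%:R)) [].
- by move=> i _; exact: open_metric_ball.
- move=> y _; exists (Num.truncn (mdist point y)).+1 => //.
  by rewrite ballEmdist /= truncnS_gt.
move=> D _ cov; pose M : nat := \max_(i <- finmap.enum_fset D) i.
have hM y : mdist point y <= M%:R.
  have [i /= iD] := cov y I; rewrite ballEmdist /= => yi.
  apply: le_trans (ltW yi) _; rewrite ler_nat.
  by rewrite /M; exact: leq_bigmax_seq.
exists (2 * M%:R) => y z; apply: le_trans (metric_triangle y point z) _.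
by have := hM y; have := hM z; rewrite metric_sym; lra.
Qed.

Section Approximation.
Variables (A : set (set X)).
Hypotheses (Xc : compact [set: X]) (Apart : measurable_partition A).

(** Compactness enters here: the suprema defining the diameters are over bounded
    sets, hence they are upper bounds. *)
Lemma mdist_le_diam_cyl k y z : same_itinerary T A k y z ->
  mdist y z <= diam_cyl T A k.
Proof.
move=> yz; have [M hM] := compact_mdist_bounded Xc.
have [D cD Dy] := exists_cylinder T Apart k y.
have Dz : D z by apply/(cylinder_same_itinerary Apart z cD Dy).
have bD (E : set X) : has_ubound [set mdist y z | y in E & z in E].
  by exists M => _ [a _ [b _ <-]]; exact: hM.
apply: (@le_trans _ _ (diam D)).
  by apply: ub_le_sup => //; exists y => //; exists z.
apply: ub_le_sup; last by exists D.
exists M => _ [E [[a Ea] _] <-]; apply: ge_sup.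
  by exists (mdist a a); exists a => //; exists a.
by move=> _ [b _ [c _ <-]]; exact: hM.
Qed.

(** If the cylinder of [y] is not inside the Bowen ball, some [z] in it is at
    distance at least [eps] from the orbit of [x] at a time [k < n].  After [k]
    steps [y] and [z] still share [N n - k] symbols, so [y] is then at distance at
    least [eps] minus the diameter of the cylinders of that length. *)
Lemma bowen_sub_inner (N : nat -> nat) eps n x : 0 < eps -> (n <= N n)%N ->
  bowen T eps n x `\` bowen_inner T A N eps n x `<=`
  \bigcup_(k in `I_n) (iter k T @^-1` (ball (iter k T x) eps `\`
     ball (iter k T x) (eps - diam_cyl T A (N n - k)))).
Proof.
move=> e0 nN y [By nUy].
apply: contrapT => nex; apply: nUy.
have [D cD Dy] := exists_cylinder T Apart (N n) y.
exists D => //; split=> // z Dz; apply/bowenP => // k kn.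
have yz := (cylinder_same_itinerary Apart z cD Dy).1 Dz.
apply: contrapT => nball; apply: nex; exists k => //; split.
  by move/bowenP: By; apply.
rewrite /= ballEmdist /= => xy; apply: nball; rewrite ballEmdist /=.
apply: le_lt_trans (metric_triangle _ (iter k T y) _) _.
suff : mdist (iter k T y) (iter k T z) <= diam_cyl T A (N n - k) by lra.
apply: mdist_le_diam_cyl; apply: same_itinerary_iter.
by rewrite subnKC// (leq_trans (ltnW kn)).
Qed.

Variable mu : probability (borel X) R.
Hypotheses (Tcont : continuous T) (Tinv : invariant_measure mu T).

Lemma measurable_ball x eps : measurable (ball x eps : set (borel X)).
Proof. by apply: open_borel; exact: open_metric_ball. Qed.

Lemma measurable_bowen eps n x : 0 < eps ->
  measurable (bowen T eps n x : set (borel X)).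
Proof.
move=> e0.
have -> : bowen T eps n x =
    \bigcap_k (if (k < n)%N then iter k T @^-1` ball (iter k T x) eps else setT).
  apply/seteqP; split=> y.
    by move=> /bowenP By k _; case: ifP => // kn; exact: By.
  by move=> h; apply/bowenP => // k kn; have := h k I; rewrite kn.
apply: (@bigcapT_measurable _ (borel X)) => k; case: ifP => _ //.
by apply: measurable_preimage_iter => //; exact: measurable_ball.
Qed.

(** The annuli of [bowen_sub_inner] are within those measured by [phi], and the
    normalisation of [phi] by the measure of a ball only helps, this measure being
    at most 1. *)
Lemma pr_bowen_sub_inner (N : nat -> nat) eps n x (c : R) :
  0 < eps -> (0 < n)%N -> (n <= N n)%N -> 0 < pr mu (bowen T eps n x) ->
  (forall k, (k < n)%N ->
     phi mu eps (diam_cyl T A (N n - k)) (iter k T x) <= c / n%:R) ->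
  pr mu (bowen T eps n x `\` bowen_inner T A N eps n x) <= c.
Proof.
move=> e0 n0 nN B0 hphi.
have mB := @measurable_bowen eps n x e0.
have mU : measurable (bowen_inner T A N eps n x : set (borel X)).
  by apply: (measurable_determined Apart Tcont);
    exact: (determined_cylinder_union Apart).
pose S k := iter k T @^-1` (ball (iter k T x) eps `\`
     ball (iter k T x) (eps - diam_cyl T A (N n - k))).
have mS k : measurable (S k : set (borel X)).
  by apply: measurable_preimage_iter => //; apply: measurableD; exact: measurable_ball.
have pS k : (k < n)%N -> pr mu (S k) <= c / n%:R.
  move=> kn; rewrite pr_preimage_iter//; last first.
    by apply: measurableD; exact: measurable_ball.
  have := hphi k kn; rewrite /phi; set g := diam_cyl _ _ _.
  have g0 : 0 <= g.
    have := @mdist_le_diam_cyl (N n - k) x x; rewrite mdistxx; apply.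
    by [].
  have sub r : 0 <= r -> ball (iter k T x) eps `<=` ball (iter k T x) (eps + r).
    by move=> r0; apply: le_ball; lra.
  set b := pr mu (ball _ eps).
  (* At a ball of measure 0 the quotient [phi] would be 0 by convention. *)
  have b0 : 0 < b.
    apply: lt_le_trans B0 _.
    rewrite /b -(pr_preimage_iter Tcont Tinv k (measurable_ball _ _)).
    apply: pr_le => //; last by move=> y /bowenP; apply.
    by apply: measurable_preimage_iter => //; exact: measurable_ball.
  have b1 : b <= 1 by apply: pr_le1; exact: measurable_ball.
  have bg : b <= pr mu (ball (iter k T x) (eps + g)).
    by apply: pr_le; [exact: measurable_ball|exact: measurable_ball|exact: sub].
  have sub' : ball (iter k T x) (eps - g) `<=` ball (iter k T x) eps.
    by apply: le_ball; lra.
  rewrite (pr_setDS mu _ _ sub'); [|exact: measurable_ball|exact: measurable_ball].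
  have bg' : pr mu (ball (iter k T x) (eps - g)) <= b.
    by apply: pr_le; [exact: measurable_ball|exact: measurable_ball|exact: sub'].
  rewrite ler_pdivrMr// -/b => h.
  apply: le_trans (_ : c / n%:R * b <= _); first by apply: le_trans h; rewrite lerD2r.
  have : 0 <= c / n%:R * b.
    by apply: le_trans h; rewrite subr_ge0; exact: le_trans bg' bg.
  by rewrite pmulr_lge0// => cn0; exact: ler_piMr.
have sub := @bowen_sub_inner N eps n x e0 nN.
rewrite (bigcup_mkord n S) in sub.
apply: le_trans (pr_le _ _ _ sub) _.
- exact: measurableD.
- exact: (@bigsetU_measurable _ (borel X)).
apply: le_trans (pr_bigsetU_le mu n mS) _.
apply: le_trans (_ : \sum_(k < n) c / n%:R <= _).
  by apply: ler_sum => i _; exact: pS.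
rewrite sumr_const card_ord -[_ *+ n]mulr_natr divfK//.
by rewrite pnatr_eq0 -lt0n.
Qed.

End Approximation.
End BowenBalls.

(** * The exponential law *)

Section ErrorTerms.
Variable R : realType.
Implicit Types (f m K L t P : R).

(** The inequality of arithmetic and geometric means for [f * m] and
    [L ^+ 2 * (K / f)], whose product is independent of [f]. *)
Lemma tradeoff_lower_bound f m K L : 0 < f -> 0 <= m -> 0 <= K -> 0 <= L ->
  L * Num.sqrt (K * m) <= 2 * f * m + L ^+ 2 * (K / f).
Proof.
move=> f0 m0 K0 L0; set g := Num.sqrt (K * m).
have g0 : 0 <= g := sqrtr_ge0 _.
have gE : g ^+ 2 = f * m * (K / f).
  by rewrite sqr_sqrtr ?mulr_ge0//; field; rewrite gt_eqF.
have b0 : 0 <= K / f by rewrite divr_ge0// ltW.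
have a0 : 0 <= f * m by rewrite mulr_ge0// ltW.
rewrite -mulrA; set a := f * m in gE a0 *; set b := K / f in gE b0 *.
have Lb : 0 <= L ^+ 2 * b by rewrite mulr_ge0// sqr_ge0.
have Lg : (L * g) ^+ 2 <= (2 * a + L ^+ 2 * b) ^+ 2.
  have -> : (L * g) ^+ 2 = a * (L ^+ 2 * b) by rewrite exprMn gE; ring.
  by nra.
rewrite leNgt; apply/negP => lt; move: Lg; apply/negP; rewrite -ltNge.
by rewrite ltr_pXn2r// nnegrE; lra.
Qed.

(** From [1 - t <= exp(- t) <= 1 / (1 + t)], the difference is at most [t] in one
    direction; in the other the linear lower bound for [P] is used for
    [t <= 1 / 2], and [0 <= P] for larger [t]. *)
Lemma exp_crude_bound P t : 0 <= t -> 1 - 2 * t <= P <= 1 -> 0 <= P ->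
  `|P - expR (- t)| <= 3 / 2 * t.
Proof.
move=> t0 /andP[P1 P2] P0; have e1 := expR_ge1Dx (- t).
have e0 := expR_gt0 (- t).
have : expR (- t) * (1 + t) <= 1.
  by rewrite -[leRHS](expRxMexpNx_1 t) [leRHS]mulrC ler_wpM2l ?expR_ge1Dx// ltW.
set x := expR (- t) in e0 e1 * => xt.
rewrite ler_norml; apply/andP; split; last by lra.
have [t1|t1] := lerP t (1 / 2); first by nra.
by nra.
Qed.

(** The block length is [sqrt (K / m)] rounded up: it balances the two errors
    [F * m] and [K / F], which are then both of order [sqrt (K * m)]. *)
Lemma optimal_block_length (K m s : R) : 0 < s <= K -> 1 <= s -> 0 < m <= 1 ->
  Num.sqrt (K * m) < 1 / 8 ->
  exists F : nat, [/\ 8 * s < F%:R, F%:R * m <= 2 * Num.sqrt (K * m) &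
    K <= F%:R * Num.sqrt (K * m)].
Proof.
move=> /andP[s0 sK] s1 /andP[m0 m1].
have K0 : 0 < K by exact: lt_le_trans sK.
pose w := Num.sqrt (K / m).
have w0 : 0 < w by rewrite sqrtr_gt0 divr_gt0.
have wK : w ^+ 2 * m = K.
  by rewrite sqr_sqrtr ?divr_ge0 ?ltW// divfK// gt_eqF.
have -> : Num.sqrt (K * m) = w * m.
  have -> : K * m = (w * m) ^+ 2 by rewrite -wK; ring.
  by rewrite sqrtr_sqr ger0_norm// mulr_ge0 ?ltW.
move=> g8; exists (Num.truncn w).+1.
have /andP[Fw wF] := truncn_itv (ltW w0).
have w8 : 8 * s < w.
  have : w * (w * m) < w * (1 / 8) by rewrite ltr_pM2l.
  have -> : w * (w * m) = K by rewrite -wK; ring.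
  by lra.
split; first exact: lt_trans wF.
  by rewrite mulrA ler_pM2r// -natr1; lra.
by rewrite -wK expr2 -mulrA ler_pM2r ?mulr_gt0// ltW.
Qed.

End ErrorTerms.

Section ExponentialLaw.
Variables (R : realType) (X : pointedMetricType R) (T : X -> X).
Variables (mu : probability (borel X) R) (A : set (set X)) (alpha : nat -> R).
Hypotheses (Tcont : continuous T) (Tinv : invariant_measure mu T).
Hypotheses (Apart : measurable_partition A) (mix : alpha_mixing mu T A alpha).
Variables (N k : nat) (U : set X) (c' : R).
Hypotheses (dU : determined T A N U) (N0 : (0 < N)%N) (c'01 : 0 < c' < 1).
Let u := pr mu U.
Let s : R := (N + k)%:R.
Let c := (1 - c') / 4.
Let p j := pr mu (avoid T U j).
Hypotheses (ak : alpha k <= c' * u) (u0 : 0 < u).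

Let mU : measurable (U : set (borel X)).
Proof. exact: measurable_determined dU. Qed.

Let s1 : 1 <= s.
Proof. by rewrite ler1n addn_gt0 N0. Qed.

Let c01 : 0 < c < 1.
Proof. by rewrite /c; move: c'01 => /andP[? ?]; apply/andP; split; lra. Qed.

(** [F %/ (N + k)] observations take place in a block; [s <= F] makes their number
    comparable with [F / s]. *)
Lemma block_visit_lower (F : nat) : s <= F%:R -> F%:R * u <= 1 ->
  c * (F%:R * u) / s <= 1 - p F.
Proof.
move=> sF Fu; have c'1 : c' <= 1 by case/andP: c'01 => _ /ltW.
have s0 : 0 < s by exact: lt_le_trans s1.
pose q := (F %/ (N + k))%N.
have qF : (q * (N + k) <= F)%N by exact: leq_divM.
have qs : F%:R <= 2 * (q%:R * s).
  have h : F%:R < q.+1%:R * s.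
    by rewrite -natrM ltr_nat ltn_ceil// addn_gt0 N0.
  have q1 : 1 * s <= q%:R * s.
    rewrite ler_pM2r// ler1n divn_gt0 ?addn_gt0 ?N0//.
    by move: sF; rewrite ler_nat.
  by move: h q1; rewrite -natr1 mulrDl; lra.
have qu : q%:R * u <= 1.
  by apply: le_trans Fu; rewrite ler_pM2r// ler_nat leq_div.
apply: le_trans (_ : (1 - c') / 2 * (q%:R * u) <= _); last first.
  by apply: (pr_visit_lower Tcont Tinv Apart mix dU c'1 ak _ qF qu);
    rewrite addn_gt0 N0.
rewrite ler_pdivrMr//.
have -> : (1 - c') / 2 * (q%:R * u) * s = c * (2 * (q%:R * s) * u).
  by rewrite /c; field.
by case/andP: c01 => c0 _; rewrite ler_pM2l// ler_pM2r.
Qed.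

Lemma block_visit_upper (F : nat) : 1 - p F <= F%:R * u.
Proof.
have := @survival_lower R p u (fun a => pr_avoidS_ge Tcont Tinv a mU) 0 F.
by rewrite {1}/p avoid0 pr_setT add0n; lra.
Qed.

Let K := s * N%:R + s * (alpha N / u).

(** The one-step error [2 * N * u + alpha N] divided by the lower bound
    [c * F * u / s] of [1 - p F] is at most [2 / c * (K / F)]. *)
Lemma block_law (F : nat) r : (2 * N <= F)%N -> s <= F%:R -> F%:R * u < 1 ->
  0 <= r ->
  `|p (Num.truncn r) - expR (r * (ln (p F) / F%:R))|
    <= 2 * (F%:R * u) + 2 / c * (K / F%:R).
Proof.
move=> NF sF Fu r0.
have s0 : 0 < s by exact: lt_le_trans s1.
have F0 : 0 < F%:R :> R by exact: lt_le_trans sF.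
have F0' : (0 < F)%N by rewrite -(ltr_nat R).
case/andP: c01 => c0 _.
pose e := 2 * N%:R * u + alpha N.
have mulF b : `|p (F + b)%N - p F * p b| <= e.
  exact: (pr_avoid_almost_mul Tcont Tinv Apart mix dU).
have p0 : p 0 = 1 by rewrite /p avoid0 pr_setT.
have decr a : p a.+1 <= p a by exact: pr_avoidS_le.
have step a : p a - u <= p a.+1 by exact: pr_avoidS_ge.
have low := block_visit_lower sF (ltW Fu).
have low0 : 0 < c * (F%:R * u) / s.
  by rewrite divr_gt0// mulr_gt0// mulr_gt0.
have pF : 0 < p F < 1.
  by move: low low0 (block_visit_upper F) Fu => *; apply/andP; split; lra.
apply: le_trans (survival_exponential p0 decr step F0' pF mulF r0) _.
rewrite lerD2l ler_pdivrMr; last by rewrite subr_gt0; case/andP: pF.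
have K0 : 0 <= K / F%:R.
  have a0 : 0 <= alpha N / u.
    by rewrite divr_ge0 ?(ltW u0)//; exact: alpha_ge0 Apart mix _.
  by rewrite divr_ge0 ?ler0n// addr_ge0// mulr_ge0 ?ler0n// ltW.
apply: le_trans (_ : 2 / c * (K / F%:R) * (c * (F%:R * u) / s) <= _); last first.
  by rewrite ler_wpM2l// mulr_ge0// divr_ge0// ltW.
have -> : 2 / c * (K / F%:R) * (c * (F%:R * u) / s) = 2 * N%:R * u + 2 * alpha N.
  by rewrite /K; field; rewrite -natrD -/s !gt_eqF//.
by rewrite lerD2l; have := alpha_ge0 Apart mix N; lra.
Qed.

(** Both bounds for the rate come from those for [1 - p F]; the condition
    [m <= 4 * u] serves to express the lower one by [m]. *)
Lemma block_rate_bounds (F : nat) m : s <= F%:R -> u <= m -> m <= 4 * u ->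
  F%:R * m <= 1 / 4 ->
  c / 8 / s < - ln (p F) / (F%:R * m) < 2.
Proof.
move=> sF um mu4 Fm.
have s0 : 0 < s by exact: lt_le_trans s1.
have F0 : 0 < F%:R :> R by exact: lt_le_trans sF.
case/andP: c01 => c0 _.
have Fu0 : 0 < F%:R * u by rewrite mulr_gt0.
have Fum : F%:R * u <= F%:R * m by rewrite ler_pM2l.
have Fm4 : F%:R * m <= 4 * (F%:R * u) by rewrite mulrCA ler_pM2l.
have Fm0 : 0 < F%:R * m by exact: lt_le_trans Fum.
have low : c * (F%:R * u) / s <= 1 - p F.
  by apply: block_visit_lower => //; move: Fum Fm; lra.
have up := block_visit_upper F.
have low0 : 0 < c * (F%:R * u) / s by rewrite divr_gt0// mulr_gt0.
have pF : 3 / 4 <= p F /\ p F < 1.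
  by move: low low0 up Fum Fm => *; split; lra.
have /andP[rate1 rate2] : 1 - p F <= - ln (p F) <= (1 - p F) / p F.
  by apply: survival_rate; case: pF => *; apply/andP; split; lra.
apply/andP; split.
  rewrite ltr_pdivlMr//; apply: lt_le_trans rate1; apply: lt_le_trans low.
  rewrite ltr_pdivlMr// mulrAC divfK ?gt_eqF//.
  apply: le_lt_trans (_ : c / 8 * (4 * (F%:R * u)) < _).
    by rewrite ler_pM2l// divr_gt0.
  by have := mulr_gt0 c0 Fu0; lra.
rewrite ltr_pdivrMr//; apply: le_lt_trans rate2 _.
case: pF => pF1 pF2; rewrite ltr_pdivrMr; last by move: pF1; lra.
apply: lt_le_trans (_ : 2 * (F%:R * m) * (3 / 4) <= _).
  by move: up Fum Fm0; lra.
by rewrite ler_pM2l// mulr_gt0.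
Qed.

(** The error here does not involve any block length, which allows one [lambda]
    to serve every [f] in the final estimate. *)
Lemma cylinder_union_hitting_law m : u <= m -> m <= 1 -> m <= 4 * u ->
  exists lambda : R, c / 8 / s < lambda < 2 /\
    forall r, 0 <= r ->
    `|p (Num.truncn r) - expR (- (lambda * m * r))| <= 8 / c * Num.sqrt (K * m).
Proof.
move=> um m1 mu4; have m0 : 0 < m by exact: lt_le_trans um.
have s0 : 0 < s by exact: lt_le_trans s1.
case/andP: c01 => c0 c1.
have N1 : 1 <= N%:R :> R by rewrite ler1n.
have sK : s <= K.
  have a0 : 0 <= s * (alpha N / u).
    by rewrite mulr_ge0 ?(ltW s0)// divr_ge0 ?(ltW u0)//; exact: alpha_ge0 Apart mix _.
  have : s * 1 <= s * N%:R by rewrite ler_pM2l.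
  by rewrite /K; move: a0; lra.
have [g8|g8] := lerP (1 / 8) (Num.sqrt (K * m)).
  (* The claimed error is at least 1, so any rate will do. *)
  exists 1; split.
    rewrite ltr_pdivrMr// mul1r; move: c1 s1.
    by move=> *; apply/andP; split; lra.
  move=> r r0.
  have p0 : 0 <= p (Num.truncn r) := pr_ge0 _ _.
  have p1 : p (Num.truncn r) <= 1 by apply: pr_le1; exact: measurable_avoid.
  have e0 := expR_gt0 (- (1 * m * r)).
  have e1 : expR (- (1 * m * r)) <= 1.
    by rewrite expR_le1 mul1r oppr_le0 mulr_ge0// ltW.
  apply: le_trans (_ : 1 <= _).
    by rewrite ler_norml; move: p0 p1 e0 e1 => *; apply/andP; split; lra.
  rewrite mulrAC ler_pdivlMr// mul1r; move: g8 c1; lra.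
have sK' : 0 < s <= K by rewrite s0 sK.
have m01 : 0 < m <= 1 by rewrite m0 m1.
have [F [FsR Fm FK]] := optimal_block_length sK' s1 m01 g8.
have sF : s <= F%:R by move: FsR s0; lra.
have F0 : 0 < F%:R :> R by exact: lt_le_trans sF.
have NF : (2 * N <= F)%N.
  have F8 : (8 * (N + k) < F)%N by rewrite -(ltr_nat R) natrM.
  by apply: leq_trans (ltnW F8); apply: leq_mul => //; exact: leq_addr.
have Fm4 : F%:R * m <= 1 / 4 by move: Fm g8; lra.
have Fum : F%:R * u <= F%:R * m by rewrite ler_pM2l.
exists (- ln (p F) / (F%:R * m)); split; first exact: block_rate_bounds.
move=> r r0.
have -> : - (- ln (p F) / (F%:R * m) * m * r) = r * (ln (p F) / F%:R).
  by field; rewrite !gt_eqF//.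
apply: le_trans (block_law NF sF _ r0) _; first by move: Fum Fm4; lra.
have gc : Num.sqrt (K * m) <= Num.sqrt (K * m) / c.
  by rewrite ler_pdivlMr// ler_piMr// ?ltW ?sqrtr_ge0.
have FK' : K / F%:R / c <= Num.sqrt (K * m) / c.
  by rewrite ler_pM2r ?invr_gt0// ler_pdivrMr// mulrC.
have := sqrtr_ge0 (K * m).
by rewrite ![_ / c * _]mulrAC; move: gc FK' Fum Fm; lra.
Qed.

End ExponentialLaw.

(** * The entry time to Bowen balls *)

Theorem theorem5 (R : realType) (X : pointedMetricType R) (T : X -> X)
    (mu : probability (borel X) R) (A : set (set X)) (alpha : nat -> R)
    (eps0 C' : R) (N : nat -> nat) (theta : nat -> R -> R) :
  let B eps n x := bowen T eps n x in
  let Bt eps n x := bowen_inner T A N eps n x in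
  let gamma k := diam_cyl T A k in
  let s eps n x : R := (spread mu T A alpha N C' eps n x)%:R in
  compact [set: X] ->
  continuous T ->
  invariant_measure mu T ->
  measurable_partition A ->
  generating mu T A ->
  alpha_mixing mu T A alpha ->
  0 < eps0 ->
  0 < C' < 1 ->
  (forall m n, (0 < m <= n)%N -> (N m <= N n)%N) ->
  (forall n, (0 < n)%N -> (n < N n)%N) ->
  (forall eps n x, 0 < eps < eps0 -> (0 < n)%N -> 0 < pr mu (B eps n x) ->
     (N n)%:R < 4^-1 * (pr mu (B eps n x))^-1) ->
  (forall eps n x k, 0 < eps < eps0 -> (0 < n)%N -> (k < n)%N ->
     0 < pr mu (Bt eps n x) -> gamma (N n - k)%N < eps ->
     phi mu eps (gamma (N n - k)%N) (iter k T x) <=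
       theta n eps * (pr mu (B eps n x) / (n%:R * s eps n x))) ->
  (forall eps, 0 < eps < eps0 -> theta ^~ eps @ \oo --> (0 : R)) ->
  exists C C5 C6 : R, 0 < C /\
    forall eps n x, 0 < eps < eps0 -> (0 < n)%N ->
      0 < pr mu (Bt eps n x) ->
      (forall k, (k < n)%N -> gamma (N n - k)%N < eps) ->
      exists lambda : R,
        C / s eps n x < lambda < 2 /\
        forall t f : R, 0 < t ->
          2 * (N n)%:R < f < 2^-1 * (pr mu (B eps n x))^-1 ->
          `|pr mu [set y |
               ((t / (lambda * pr mu (B eps n x)))%:E < tau T (B eps n x) y)%E]
            - expR (- t)|
          <= theta n eps * (t / (s eps n x * lambda))
             + 2 * f * pr mu (B eps n x)
             + C5 * (s eps n x * (N n)%:R / f)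
             + C6 * s eps n x * (alpha (N n) / (f * pr mu (Bt eps n x))).
Proof.
move=> B Bt gamma s Xc Tcont Tinv Apart _ mix _ C'01 _ nN _ hphi _.
pose c : R := (1 - C') / 4.
have [c0 c1] : 0 < c /\ c < 1.
  by rewrite /c; case/andP: C'01 => ? ?; split; lra.
exists (c / 8), ((8 / c) ^+ 2), ((8 / c) ^+ 2); split; first by rewrite divr_gt0.
move=> eps n x eps_in n0 Bt0 hgamma.
have /andP[eps_pos _] := eps_in.
have nNn := nN n n0.
pose u := pr mu (Bt eps n x); pose m := pr mu (B eps n x).
pose k := alpha_inv alpha (C' * u).
have sE : s eps n x = (N n + k)%:R by rewrite addnC.
have s2 : 2 <= s eps n x.
  by rewrite sE ler_nat (leq_trans _ (leq_addr _ _))// (leq_ltn_trans n0).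
have ak : alpha k <= C' * u.
  by apply: (alpha_invP mix); rewrite mulr_gt0//; case/andP: C'01.
set S := s eps n x in sE s2 *.
have dU : determined T A (N n) (Bt eps n x).
  exact: determined_cylinder_union.
have mU : measurable (Bt eps n x : set (borel X)).
  exact: measurable_determined dU.
have mB : measurable (B eps n x : set (borel X)) by exact: measurable_bowen.
have UB : Bt eps n x `<=` B eps n x by move=> y [D [_ DB] Dy]; exact: DB.
have um : u <= m by exact: pr_le.
have m0 : 0 < m by exact: lt_le_trans um.
have m1 : m <= 1 by exact: pr_le1.
pose th := theta n eps / S.
have hBU : m - u <= th * m.
  rewrite -(pr_setDS mu mB mU UB).
  apply: pr_bowen_sub_inner => // [|j jn]; first exact: ltnW.
  apply: le_trans (hphi eps n x j eps_in n0 jn Bt0 (hgamma j jn)) _.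
  rewrite le_eqVlt; apply/orP; left; apply/eqP; rewrite -/S -/m /th.
  by field; rewrite pnatr_eq0 -lt0n n0 gt_eqF//; lra.
have th0 : 0 <= th.
  have : 0 <= th * m by apply: le_trans hBU; rewrite subr_ge0.
  by rewrite pmulr_lge0.
have a0 : 0 <= alpha (N n) / u.
  by rewrite divr_ge0 ?(ltW Bt0)//; exact: alpha_ge0 Apart mix _.
pose K := (N n + k)%:R * (N n)%:R + (N n + k)%:R * (alpha (N n) / u).
have K0 : 0 <= K by rewrite addr_ge0// mulr_ge0.
have c8 : 0 <= 8 / c by rewrite divr_ge0// ltW.
(* With equal constants the last two error terms add up to a multiple of [K / f]. *)
have errE f : f != 0 ->
    (8 / c) ^+ 2 * (S * (N n)%:R / f) +
    (8 / c) ^+ 2 * S * (alpha (N n) / (f * u)) = (8 / c) ^+ 2 * (K / f).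
  by move=> f0; rewrite /K sE; field; rewrite f0 !gt_eqF.
have err f : 2 * (N n)%:R < f ->
    (8 / c) * Num.sqrt (K * m) <= 2 * f * m +
    (8 / c) ^+ 2 * (S * (N n)%:R / f) +
    (8 / c) ^+ 2 * S * (alpha (N n) / (f * u)).
  move=> Nf; have f0 : 0 < f by apply: le_lt_trans Nf.
  rewrite -addrA errE ?gt_eqF//.
  by apply: tradeoff_lower_bound => //; exact: ltW.
have mono j := pr_avoid_mono Tcont Tinv j mU mB UB.
have avB j : pr mu (avoid T (B eps n x) j) <= 1.
  by apply: pr_le1; exact: measurable_avoid.
have floorM lam t : 0 < lam -> 0 < t ->
    0 <= t / (lam * m) /\ (Num.truncn (t / (lam * m)))%:R * m <= t / lam.
  move=> l0 t0; have r0 : 0 <= t / (lam * m).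
    by rewrite divr_ge0 ?(ltW t0)// mulr_ge0// ltW.
  split=> //; have /andP[rl _] := truncn_itv r0.
  apply: le_trans (_ : t / (lam * m) * m <= _); first by rewrite ler_pM2r.
  by rewrite invfM mulrA divfK// gt_eqF.
(* If [th] is large, [u] may be negligible against [m]; but then the first error
   term alone is at least [3 / 2 * t] for the rate [1 / 2]. *)
have [th34|th34] := lerP (3 / 4) th.
  exists (1 / 2); split.
    rewrite ltr_pdivrMr; last by lra.
    by apply/andP; split; lra.
  move=> t f t0 /andP[Nf _]; have [r0 rm] := floorM (1 / 2) t ltac:(lra) t0.
  rewrite tau_gt//; set M := Num.truncn _ in rm *.
  have low : 1 - 2 * t <= pr mu (avoid T (B eps n x) M).
    have := @survival_lower R (fun a => pr mu (avoid T (B eps n x) a)) m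
      (fun a => pr_avoidS_ge Tcont Tinv a mB) 0 M.
    by rewrite add0n avoid0 pr_setT; lra.
  have e1 := err f Nf.
  have e2 : 0 <= (8 / c) * Num.sqrt (K * m) by rewrite mulr_ge0 ?sqrtr_ge0.
  have e3 : `|pr mu (avoid T (B eps n x) M) - expR (- t)| <= 3 / 2 * t.
    by apply: exp_crude_bound; rewrite ?(ltW t0) ?low ?avB ?pr_ge0.
  have e4 : 3 / 2 * t <= theta n eps * (t / (S * (1 / 2))).
    have -> : theta n eps * (t / (S * (1 / 2))) = 2 * th * t.
      by rewrite /th; field; rewrite gt_eqF//; lra.
    by rewrite ler_pM2r//; lra.
  by move: e1 e2 e3 e4; rewrite -/u -/m; lra.
have mu4 : m <= 4 * u.
  have : th * m <= 3 / 4 * m by rewrite ler_pM2r// ltW.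
  by lra.
have N0 : (0 < N n)%N by exact: leq_ltn_trans nNn.
have [lam [lam_in law]] := cylinder_union_hitting_law Tcont Tinv Apart mix dU N0
  C'01 ak Bt0 um m1 mu4.
exists lam; split; first by rewrite sE.
move=> t f t0 /andP[Nf _].
have l0 : 0 < lam.
  case/andP: lam_in => l1 _; apply: lt_trans l1.
  by rewrite -sE divr_gt0 ?divr_gt0//; lra.
have [r0 rm] := floorM lam t l0 t0.
rewrite tau_gt//; set M := Num.truncn _ in rm *.
have := law _ r0; rewrite -/M -/u -/K -/c.
have -> : lam * m * (t / (lam * m)) = t.
  by rewrite mulrC divfK// mulf_neq0 ?gt_eqF.
move=> e1; have e2 := err f Nf.
have e3 : M%:R * (m - u) <= theta n eps * (t / (S * lam)).
  apply: le_trans (_ : M%:R * (th * m) <= _); first by rewrite ler_wpM2l.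
  have -> : theta n eps * (t / (S * lam)) = th * (t / lam).
    by rewrite /th; field; rewrite !gt_eqF//; lra.
  by rewrite mulrCA ler_wpM2l.
have /andP[e4 e5] := mono M.
rewrite (pr_setDS mu mB mU UB) in e5.
move: e1 e2 e3 e4 e5; rewrite -/u -/m !ler_norml => /andP[e1 e1'] *.
by apply/andP; split; lra.
Qed.
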